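(* In an $n$-node cycle with two noise-corrupted leaders, where $n$ is even, the coherence $R_{NC}(S)$ is minimized (over sets $S$ of two leaders) when the leaders are at distance $n/2$ apart, and the resulting coherence is $$ R_{NC}(S)=\frac{n^3+16n^2+44n-16}{24(n+8)}. $$
   Context: All edge weights and all degrees of stubbornness $\kappa_i$ equal $1$; distance is graph distance (number of edges) in the cycle. For a connected graph with Laplacian $L$ and nonempty leader set $S\subseteq V$, let $D_\kappa$ be the diagonal matrix with entries $\kappa_i$ (here the identity) and $D_S$ the diagonal $0/1$ matrix whose $(i,i)$ entry is $1$ iff $i\in S$. The coherence for noise-corrupted leaders $S$ (total steady-state variance of all nodes under $\dot x=-(L+D_\kappa D_S)x+d$, with $d$ a vector of zero-mean unit-variance white noise processes) is $$R_{NC}(S)=\tfrac12\operatorname{tr}\big((L+D_\kappa D_S)^{-1}\big).$$ *)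

(* Defs.v *)
From mathcomp Require Import all_boot all_order all_algebra.

Set Implicit Arguments.
Unset Strict Implicit.
Unset Printing Implicit Defensive.

Import Order.TTheory GRing.Theory Num.Theory.
Local Open Scope ring_scope.

Definition walk (T : finType) (e : rel T) (k : nat) (x y : T) : bool :=
  [exists p : k.-tuple T, path e x p && (last x p == y)].

(* Shortest walks visit at most #|T| vertices, so it suffices to search the
   lengths k < #|T|; the value is #|T| when y is unreachable from x. *)
Definition gdist (T : finType) (e : rel T) (x y : T) : nat :=
  find (fun k => walk e k x y) (iota 0 #|T|).

(* For n >= 3 this is the simple n-cycle; for n = 1 it would be a loop and for
   n = 2 a single edge. *)
Definition cycle_edge (n : nat) : rel 'I_n :=
  fun i j => (j == i.+1 %% n :> nat)%N || (i == j.+1 %% n :> nat)%N.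

Definition unit_weights (R : pzRingType) (n : nat) (e : rel 'I_n) : 'M[R]_n :=
  \matrix_(i, j) (e i j)%:R.

Definition laplacian (R : pzRingType) (n : nat) (W : 'M[R]_n) : 'M[R]_n :=
  diag_mx (\row_i \sum_j W i j) - W.

Definition leader_mx (R : pzRingType) (n : nat) (S : {set 'I_n}) : 'M[R]_n :=
  diag_mx (\row_i (i \in S)%:R).

(* The argument of invmx is a unit when the weighted graph is connected with
   positive symmetric weights, S is nonempty and kappa is positive; outside
   that range invmx returns its argument if it is singular. *)
Definition coherence_NC (R : realFieldType) (n : nat) (W : 'M[R]_n)
    (kappa : 'rV[R]_n) (S : {set 'I_n}) : R :=
  2^-1 * \tr (invmx (laplacian W + diag_mx kappa *m leader_mx R S)).

Definition cycle_coherence_NC (R : realFieldType) (n : nat)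
    (S : {set 'I_n}) : R :=
  coherence_NC (unit_weights R (@cycle_edge n)) (const_mx 1) S.

(* Main.v *)
Require Import Defs.
From mathcomp Require Import all_boot all_order all_algebra.
From mathcomp Require Import ring lra zify.

Set Implicit Arguments.
Unset Strict Implicit.
Unset Printing Implicit Defensive.

Import Order.TTheory GRing.Theory Num.Theory.
Local Open Scope ring_scope.

(** Regard the cycle as an electrical network with unit resistors. The effective
    resistance between two nodes whose difference in Z/n is k is
    [resistance k] = k (n - k) / n, two arcs in parallel. As a function of k it
    has constant second difference except for a jump at k = 0, so up to
    constants it is a Green function of the Laplacian on the vertex-transitive
    cycle ([resistance_second_difference]).

    Making a and b leaders adds unit mass to the diagonal of the Laplacian at a
    and b. Column j of the inverse is therefore the Green function with pole j,
    corrected by a combination of the Green functions with poles a and b and a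
    constant; solving for the three coefficients gives the explicit inverse
    [green] ([green_inverse]). Its trace involves only the sum of resistances
    to a fixed node, which is the same for all nodes, and the sum over j of the
    squared differences of the resistances from j to a and to b. On each of
    the two arcs between a and b that difference is affine in the position of
    j, so the second sum is elementary, and it turns out to depend on a and b
    only through rho, the resistance between a and b
    ([sum_sqr_sub_resistance]). Hence so does the coherence
    ([coherence_cycle]):
      2 R_NC = (n^2 - 1) / 6 + n / 2 - n rho / 4
               - (n rho^2 + 2 rho) / (12 (2 + rho)).

    This is decreasing in rho >= 0 ([coherence_antitone]), and
    rho = k (n - k) / n is at most n / 4 by the inequality between arithmetic
    and geometric means, with equality at k = n / 2, that is, for antipodal
    leaders. Substituting rho = n / 4 gives the stated value. *)

(** * Power sums *)

Lemma sum_mul_sub (R : realFieldType) (c : R) (k : nat) :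
  \sum_(0 <= i < k) i%:R * (c - i%:R) =
  k%:R * (k%:R - 1) * (3 * c - 2 * k%:R + 1) / 6.
Proof.
elim: k => [|k IHk]; first by rewrite big_geq //; field.
by rewrite big_nat_recr //= IHk -natr1; field.
Qed.

Lemma sum_sqr_arith (R : realFieldType) (c : R) (k : nat) :
  \sum_(0 <= i < k) (2 * i%:R - c) ^+ 2 =
  k%:R * (c ^+ 2 - 2 * c * (k%:R - 1)
          + 2 * (k%:R - 1) * (2 * k%:R - 1) / 3).
Proof.
elim: k => [|k IHk]; first by rewrite big_geq //; field.
by rewrite big_nat_recr //= IHk -natr1; field.
Qed.

(** * Resistance distance on the cycle *)

(** Effective resistance of two wires of resistances x and n - x in parallel.
    Taking x in the field gives a polynomial that can be evaluated at the
    successor of n - 1 without reduction modulo n. *)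
Definition parallel_arcs (R : realFieldType) (n x : R) : R :=
  x * (n - x) / n.

Definition resistance (R : realFieldType) (n : nat) (k : 'I_n) : R :=
  parallel_arcs n%:R (k : nat)%:R.

Section Cycle.
Variables (R : realFieldType) (m : nat).
Local Notation n := m.+3.
Implicit Types (i j k a b : 'I_n).
Local Notation res := (@resistance R n).
Local Notation N := (n%:R : R).

Let N_neq0 : N != 0. Proof. by rewrite pnatr_eq0. Qed.
Let N_gt0 : 0 < N. Proof. by rewrite ltr0n. Qed.

Lemma resistance0 : res 0 = 0.
Proof. by rewrite /resistance /parallel_arcs mulr0n !mul0r. Qed.

Lemma val_oppS k : k != 0 -> (- k : 'I_n) = (n - k)%N :> nat.
Proof.
move=> k0; rewrite /= modn_small // ltn_subrL /=.
by rewrite lt0n andbT.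
Qed.

Lemma resistanceN k : res (- k) = res k.
Proof.
have [->|k0] := eqVneq k 0; first by rewrite oppr0.
rewrite /resistance val_oppS // natrB ?(ltnW (ltn_ord k)) //.
by rewrite /parallel_arcs; ring.
Qed.

Lemma resistance_ge0 k : 0 <= res k.
Proof.
rewrite /resistance /parallel_arcs divr_ge0 ?ler0n // mulr_ge0 ?ler0n //.
by rewrite subr_ge0 ler_nat ltnW.
Qed.

(** The polynomial vanishes at both 0 and n, so the step from n - 1 back to 0
    needs no special case. *)
Lemma resistanceS k : res (k + 1) = parallel_arcs N (k%:R + 1).
Proof.
rewrite /resistance natr1.
have -> : (k + 1 : 'I_n) = (k.+1 %% n)%N :> nat.
  by rewrite /= addn1.
have [lt_kn|ge_kn] := ltnP k.+1 n; first by rewrite modn_small.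
have -> : k.+1 = n by apply/eqP; rewrite eqn_leq ge_kn ltn_ord.
by rewrite modnn /parallel_arcs subrr mulr0 mulr0n !mul0r.
Qed.

(** The left-hand side is the Laplacian of the cycle applied to [resistance].
    Away from 0 it is the second difference of a quadratic polynomial; at 0
    the two arcs meet with a corner. *)
Lemma resistance_second_difference k :
  2 * res k - res (k + 1) - res (k - 1) = 2 / N - 2 * (k == 0)%:R.
Proof.
(* evenness turns the predecessor into a successor *)
have -> : k - 1 = - (- k + 1) by rewrite opprD opprK.
rewrite resistanceN !resistanceS.
have [->|k0] := eqVneq k 0.
  rewrite oppr0 resistance0 /parallel_arcs /= !mulr0n.
  by field; rewrite -natrD pnatr_eq0.
rewrite val_oppS // natrB ?(ltnW (ltn_ord k)) // /resistance.
by rewrite /parallel_arcs /=; field; rewrite -natrD pnatr_eq0.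
Qed.

Lemma sum_resistance a : \sum_j res (j - a) = (N ^+ 2 - 1) / 6.
Proof.
rewrite (reindex_inj (addIr a)) /=.
under eq_bigr => j _ do rewrite addrK.
rewrite -(big_mkord xpredT (fun j : nat => parallel_arcs N j%:R)).
rewrite /parallel_arcs -mulr_suml sum_mul_sub.
by field; rewrite -natrD pnatr_eq0.
Qed.

Lemma val_sub_ge j a : (a <= j)%N -> (j - a : 'I_n) = (j - a)%N :> nat.
Proof.
move=> le_aj; rewrite /= modnDmr addnBA ?(ltnW (ltn_ord a)) //.
rewrite addnC -addnBA // modnDl modn_small //.
exact: leq_ltn_trans (leq_subr _ _) (ltn_ord j).
Qed.

(** Cutting the cycle at 0 and a leaves arcs of lengths a and n - a. On each the
    difference is affine, with slope proportional to the length of the other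
    arc, and it runs between - res a and res a. *)
Lemma sum_sqr_sub_resistance0 a :
  \sum_j (res j - res (j - a)) ^+ 2 = (N * res a ^+ 2 + 2 * res a) / 3.
Proof.
have res_ge j : (a <= j)%N -> res (j - a) = parallel_arcs N (j%:R - a%:R).
  by move=> le_aj; rewrite /resistance val_sub_ge // natrB.
pose F (j : nat) : R := (parallel_arcs N j%:R
  - parallel_arcs N `|j%:R - a%:R|) ^+ 2.
transitivity (\sum_(j < n) F j).
  apply: eq_bigr => j _; rewrite /F.
  have [le_aj|/ltnW le_ja] := leqP a j.
    by rewrite res_ge // ger0_norm // subr_ge0 ler_nat.
  rewrite -[res (j - a)]resistanceN opprB /resistance val_sub_ge // natrB //.
  by rewrite distrC ger0_norm // subr_ge0 ler_nat.
rewrite -(big_mkord xpredT F) (@big_cat_nat _ _ _ a) //=; last exact: ltnW.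
have -> : \sum_(0 <= j < a) F j =
    ((N - a%:R) / N) ^+ 2 * \sum_(0 <= j < a) (2 * j%:R - a%:R) ^+ 2.
  rewrite mulr_sumr; apply: eq_big_nat => j /andP[_ lt_ja].
  rewrite /F distrC ger0_norm ?subr_ge0 ?ler_nat ?(ltnW lt_ja) //.
  by rewrite /parallel_arcs; field; rewrite -natrD pnatr_eq0.
have -> : \sum_(a <= j < n) F j =
    (a%:R / N) ^+ 2 * \sum_(0 <= j < n - a) (2 * j%:R - (N - a%:R)) ^+ 2.
  rewrite -[X in \sum_(X <= _ < _) _]add0n big_addn mulr_sumr.
  apply: eq_big_nat => j _.
  rewrite /F natrD addrK ger0_norm ?ler0n //.
  by rewrite /parallel_arcs; field; rewrite -natrD pnatr_eq0.
rewrite !sum_sqr_arith natrB ?(ltnW (ltn_ord a)) //.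
by rewrite /resistance /parallel_arcs; field; rewrite -natrD pnatr_eq0.
Qed.

Lemma sum_sqr_sub_resistance a b :
  \sum_j (res (j - a) - res (j - b)) ^+ 2 =
  (N * res (b - a) ^+ 2 + 2 * res (b - a)) / 3.
Proof.
rewrite -sum_sqr_sub_resistance0 (reindex_inj (addIr a)) /=.
by apply: eq_bigr => j _; rewrite addrK opprB addrA.
Qed.

(** * Inverse of the grounded Laplacian *)

(** In the additive group of Z/n the edges are the translations by 1 and - 1,
    which makes the graph translation invariant. *)
Lemma cycle_edgeE i j : cycle_edge i j = (j == i + 1) || (j == i - 1).
Proof.
have addr1E (k l : 'I_n) : (k == l.+1 %% n :> nat)%N = (k == l + 1).
  by rewrite -val_eqE /= addn1.
by rewrite /cycle_edge !addr1E (eq_sym j (i - 1)) subr_eq.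
Qed.

Lemma sum_cycle_edge i (g : 'I_n -> R) :
  \sum_j (cycle_edge i j)%:R * g j = g (i + 1) + g (i - 1).
Proof.
(* n >= 3 is what separates the two neighbours *)
have ne : i - 1 != i + 1.
  rewrite -subr_eq0 opprD addrACA subrr add0r -opprD oppr_eq0.
  by rewrite -val_eqE.
rewrite (bigD1 (i + 1)) //= (bigD1 (i - 1)) //= big1 ?addr0.
  by rewrite !cycle_edgeE !eqxx orbT !mul1r.
by move=> j /andP[/negPf j1 /negPf j2]; rewrite cycle_edgeE j1 j2 mul0r.
Qed.

Definition grounded (S : {set 'I_n}) : 'M[R]_n :=
  laplacian (unit_weights R (@cycle_edge n))
  + diag_mx (const_mx 1) *m leader_mx R S.

Lemma groundedM S (X : 'M[R]_n) i j :
  (grounded S *m X) i j =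
  2 * X i j - X (i + 1) j - X (i - 1) j + (i \in S)%:R * X i j.
Proof.
rewrite /grounded diag_const_mx mul1mx mulmxDl mxE; congr (_ + _).
  rewrite /laplacian mulmxBl mul_diag_mx !mxE.
  under eq_bigr => k _ do rewrite mxE -[_%:R]mulr1.
  rewrite sum_cycle_edge.
  under eq_bigr => k _ do rewrite mxE.
  by rewrite (sum_cycle_edge i (X^~ j)) opprD addrA.
by rewrite /leader_mx mul_diag_mx !mxE.
Qed.

Lemma invmx_eq (F : fieldType) p (A B : 'M[F]_p) : A *m B = 1%:M -> invmx A = B.
Proof.
move=> AB1; have [uA _] := mulmx1_unit AB1.
by rewrite -[B](mulKmx uA) AB1 mulmx1.
Qed.

(** With r the resistance distance and rho = r a b, seek column j of the inverse
    in the form x i = - r i j / 2 + alpha r i a + beta r i b + gamma. By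
    [resistance_second_difference] the grounded Laplacian maps x to the unit
    vector at j as soon as alpha + beta = 1 / 2, x a = 2 alpha and
    x b = 2 beta. The solution of this linear system is
    alpha = 1 / 4 + s / 2, beta = 1 / 4 - s / 2 and the constant gamma on the
    last line. *)
Definition green a b : 'M[R]_n := \matrix_(i, j)
  let s := (res (j - b) - res (j - a)) / (2 * (2 + res (b - a))) in
  - res (i - j) / 2 + (1 / 4 + s / 2) * res (i - a)
  + (1 / 4 - s / 2) * res (i - b)
  + (1 / 2 - res (b - a) / 4 + (res (j - a) + res (j - b)) / 4).

Lemma green_inverse a b : a != b -> grounded [set a; b] *m green a b = 1%:M.
Proof.
move=> neq_ab; apply/matrixP => i j; rewrite groundedM.
have D k : res (i + 1 - k) =
    2 * res (i - k) - 2 / N + 2 * (i == k)%:R - res (i - 1 - k).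
  have := resistance_second_difference (i - k).
  by rewrite subr_eq0 (addrAC i 1) (addrAC i (- 1)); move: (2 / N) => x E; lra.
have rho_ge0 := resistance_ge0 (b - a).
have rho2 : 2 + res (b - a) != 0 by lra.
have resC k l : res (k - l) = res (l - k) by rewrite -resistanceN opprB.
set s := (res (j - b) - res (j - a)) / (2 * (2 + res (b - a))).
have at_a : green a b a j = 1 / 2 + s.
  rewrite mxE /= -/s subrr resistance0 (resC a b) (resC a j) /s.
  by field.
have at_b : green a b b j = 1 / 2 - s.
  rewrite mxE /= -/s subrr resistance0 (resC b j) /s.
  by field.
have -> : (i \in [set a; b])%:R * green a b i j =
    (i == a)%:R * (1 / 2 + s) + (i == b)%:R * (1 / 2 - s).
  rewrite !inE; have [->|_] := eqVneq i a.
    by rewrite at_a (negPf neq_ab) mul0r addr0.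
  have [->|_] := eqVneq i b; first by rewrite at_b mul0r add0r.
  by rewrite !mul0r addr0.
by rewrite !mxE /= -/s !D; field; rewrite -natrD pnatr_eq0.
Qed.

(** On the diagonal r j j = 0 leaves half the sum of r j a and r j b, a
    constant, and a multiple of (r j a - r j b) ^ 2. *)
Lemma trace_green a b : \tr (green a b) =
  (N ^+ 2 - 1) / 6 + N / 2 - N * res (b - a) / 4
  - (N * res (b - a) ^+ 2 + 2 * res (b - a)) / (12 * (2 + res (b - a))).
Proof.
have rho_ge0 := resistance_ge0 (b - a).
have rho2 : 2 + res (b - a) != 0 by lra.
(* hiding the constant keeps big_split from splitting it *)
have [c cE] : exists c, c = 1 / 2 - res (b - a) / 4 by eexists.
transitivity (\sum_j (1 / 2 * res (j - a) + 1 / 2 * res (j - b)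
    + c - (res (j - a) - res (j - b)) ^+ 2 * (1 / (4 * (2 + res (b - a)))))).
  by apply: eq_bigr => j _; rewrite mxE /= subrr resistance0 cE; field.
rewrite sumrB !big_split /= sumr_const card_ord -[c *+ n]mulr_natr.
rewrite -!mulr_sumr !sum_resistance -mulr_suml sum_sqr_sub_resistance.
by rewrite cE; field.
Qed.

Lemma coherence_cycle a b : a != b ->
  cycle_coherence_NC R [set a; b] =
  2^-1 * ((N ^+ 2 - 1) / 6 + N / 2 - N * res (b - a) / 4
  - (N * res (b - a) ^+ 2 + 2 * res (b - a)) / (12 * (2 + res (b - a)))).
Proof.
move=> neq_ab; rewrite -trace_green /cycle_coherence_NC /coherence_NC.
by rewrite -/(grounded _) (invmx_eq (green_inverse neq_ab)).
Qed.

(** Arithmetic-geometric mean inequality for the lengths of the two arcs. *)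
Lemma resistance_le k : res k <= N / 4.
Proof.
rewrite /resistance /parallel_arcs ler_pdivrMr // -subr_ge0.
have -> : N / 4 * N - k%:R * (N - k%:R) = (N / 2 - k%:R) ^+ 2 by field.
exact: sqr_ge0.
Qed.

(** Leaders that are electrically farther apart have a smaller coherence: both
    n rho / 4 and (n rho^2 + 2 rho) / (2 + rho) increase with rho >= 0. *)
Lemma coherence_antitone a b c d : a != b -> c != d ->
  res (b - a) <= res (d - c) ->
  cycle_coherence_NC R [set c; d] <= cycle_coherence_NC R [set a; b].
Proof.
move=> neq_ab neq_cd; rewrite !coherence_cycle //.
have := resistance_ge0 (b - a).
move: (res (b - a)) (res (d - c)) => x y x_ge0 le_xy.
have y_ge0 := le_trans x_ge0 le_xy.
have x2 : 0 < 2 + x by lra.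
have y2 : 0 < 2 + y by lra.
rewrite ler_pM2l ?invr_gt0 ?ltr0n // lerB //.
  by rewrite lerD2l lerN2 ler_wpM2r ?invr_ge0 // ler_wpM2l.
rewrite ler_pdivrMr ?mulr_gt0 ?ltr0n // mulrAC ler_pdivlMr ?mulr_gt0 ?ltr0n //.
rewrite -subr_ge0.
have -> : (N * y ^+ 2 + 2 * y) * (12 * (2 + x))
    - (N * x ^+ 2 + 2 * x) * (12 * (2 + y))
  = 12 * (y - x) * (N * (2 * x + 2 * y + x * y) + 4) by ring.
apply: mulr_ge0; first by rewrite mulr_ge0 ?subr_ge0.
by rewrite addr_ge0 // mulr_ge0 // ?(ltW N_gt0) // !addr_ge0 ?mulr_ge0.
Qed.

(** * Graph distance on the cycle *)

Lemma gdist_le (T : finType) (e : rel T) x y k :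
  walk e k x y -> (gdist e x y <= k)%N.
Proof.
move=> wk; rewrite leqNgt; apply/negP => lt_k.
have lt_kT : (k < #|T|)%N.
  apply: leq_trans lt_k _.
  by rewrite (leq_trans (find_size _ _)) // size_iota.
by have := before_find 0%N lt_k; rewrite nth_iota // add0n wk.
Qed.

Lemma walk_translate (e : rel 'I_n) d u k : (forall i, e i (i + d)) ->
  walk e k u (u + d *+ k).
Proof.
move=> e_step; pose f i := i + d.
have iter_f l : iter l f u = u + d *+ l.
  by elim: l => [|l IHl]; rewrite ?addr0 //= IHl /f -addrA -mulrSr.
apply/existsP; exists (tcast (size_traject f (f u) k) (in_tuple _)).
rewrite val_tcast /= last_traject iter_f eqxx andbT.
by apply: sub_path (fpath_traject f u k) => i _ /eqP <-.
Qed.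

Lemma gdist_cycle_le u v : (gdist (@cycle_edge n) u v <= (v - u)%R)%N.
Proof.
apply: gdist_le.
have : walk (@cycle_edge n) (v - u)%R u (u + 1 *+ (v - u)%R).
  by apply: walk_translate => i; rewrite cycle_edgeE eqxx.
by rewrite natr_Zp subrKC.
Qed.

Lemma gdist_cycle_le_rev u v : (gdist (@cycle_edge n) u v <= (u - v)%R)%N.
Proof.
apply: gdist_le.
have : walk (@cycle_edge n) (u - v)%R u (u + -1 *+ (u - v)%R).
  by apply: walk_translate => i; rewrite cycle_edgeE eqxx orbT.
by rewrite mulNrn natr_Zp subKr.
Qed.

Lemma antipodal_neq u v : gdist (@cycle_edge n) u v = n./2 -> u != v.
Proof.
move=> uv; apply: contra_eq_neq uv => ->.
by rewrite neq_ltn (leq_ltn_trans (gdist_cycle_le v v)) // subrr.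
Qed.

(** Walking in either direction bounds the distance by k = v - u and by n - k;
    both being at least n / 2 forces k = n / 2. Exhibiting the two walks thus
    replaces a computation of the distance. *)
Lemma resistance_antipodal u v : ~~ odd n ->
  gdist (@cycle_edge n) u v = n./2 -> res (v - u) = N / 4.
Proof.
move=> even_n uv; have neq_uv := antipodal_neq uv.
have := gdist_cycle_le u v; have := gdist_cycle_le_rev u v.
rewrite uv -(opprB v u) val_oppS ?subr_eq0 1?eq_sym // => le1 le2.
have nE : n = (n./2 + n./2)%N by rewrite addnn even_halfK.
have vE : (v - u)%R = n./2 :> nat.
  have := ltn_ord (v - u).
  by move: (nat_of_ord (v - u)) nE le1 le2; move: n./2 => h w; lia.
have NE : N = n./2%:R + n./2%:R by rewrite -natrD -nE.
have := N_neq0; rewrite /resistance vE /parallel_arcs NE.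
move: (n./2%:R : R) => h; rewrite -mulr2n mulrn_eq0 /= => h_neq0.
by field.
Qed.

End Cycle.

Theorem theorem15 (R : realFieldType) (n : nat) (hn : (3 <= n)%N)
    (heven : ~~ odd n) (u v : 'I_n)
    (huv : gdist (@cycle_edge n) u v = n./2) :
  (forall S : {set 'I_n}, #|S| = 2%N ->
     cycle_coherence_NC R [set u; v] <= cycle_coherence_NC R S) /\
  cycle_coherence_NC R [set u; v] =
    (n%:R ^+ 3 + 16 * n%:R ^+ 2 + 44 * n%:R - 16) / (24 * (n%:R + 8)).
Proof.
case: n hn heven u v huv => [|[|[|m]]] // _ even_n u v uv.
have neq_uv := antipodal_neq uv.
have resE := resistance_antipodal R even_n uv.
split=> [S /eqP/cards2P[a [b [neq_ab ->]]]|].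
  by apply: coherence_antitone => //; rewrite resE resistance_le.
rewrite coherence_cycle // resE.
have : 0 < m.+3%:R :> R by rewrite ltr0n.
move: m.+3%:R => x x_gt0.
by field; rewrite gt_eqF // addr_gt0.
Qed.
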